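(* A graph class $\mathcal{C}$ is interpretable in a class of locally almost bounded degree by a bounded range interpretation (i.e. there exist a class $\mathcal{D}$ of locally almost bounded degree and an interpretation $I$ of bounded range with $\mathcal{C}\subseteq\{I(H):H\in\mathcal{D}\}$) if and only if $\mathcal{C}$ is locally almost near-covered.
   Context: Graphs are finite, simple, and may be colored by unary predicates; graph-theoretic properties refer to the underlying graph. $N^G(v)$ is the set of neighbors of $v$; $N_r^G(v)$ is the closed $r$-neighborhood of $v$ (vertices at distance at most $r$, including $v$); $\mathrm{dist}_G$ is graph distance. A class $\mathcal{D}$ has locally almost bounded degree if there exist $f,d:\mathbb{N}\to\mathbb{N}$ such that for every $r$, every $G\in\mathcal{D}$ and every $v\in V(G)$, $N_r^G(v)$ contains at most $f(r)$ vertices of degree larger than $d(r)$ in $G$. An interpretation $I=(\psi,\delta)$ consists of first-order formulas $\psi(x,y)$, $\delta(x)$ in the signature of (colored) graphs, $\psi$ symmetric and irreflexive; $I(G)$ has vertex set $\{v:G\models\delta(v)\}$ and edges $uv$ ($u\neq v$) with $G\models\psi(u,v)$. $\psi$ has range $b$ if for all graphs $G$ and $u,v\in V(G)$, $\mathrm{dist}_G(u,v)>b$ implies $G\not\models\psi(u,v)$; $I$ is of bounded range if $\psi$ has range $b$ for some $b$. Two vertices are $k$-near-twins in $G$ if $|N^G(u)\,\Delta\,N^G(v)|\le k$. $G$ is $(k,m)$-near-covered if every set of vertices that are pairwise not $k$-near-twins has size at most $m$. $\mathcal{C}$ is locally almost near-covered if there exist $k,m:\mathbb{N}\to\mathbb{N}$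 such that for every $r$, every $G\in\mathcal{C}$ and every $v\in V(G)$, the induced subgraph $G[N_r^G(v)]$ is $(k(r),m(r))$-near-covered. *)

(* Defs.v *)
From HB Require Import structures.
From mathcomp Require Import all_boot.
Set Implicit Arguments.
Unset Strict Implicit.
Unset Printing Implicit Defensive.

Record graph := Graph {
  gV : finType;
  gE : rel gV;
  gE_sym : symmetric gE;
  gE_irr : irreflexive gE }.

Record cgraph := CGraph {
  cgG : graph;
  cgcol : gV cgG -> nat -> bool }.

Inductive formula :=
| FEq of nat & nat
| FEdge of nat & nat
| FCol of nat & nat          (* FCol c x : x has color c *)
| FNot of formula
| FAnd of formula & formula
| FEx of nat & formula.

Fixpoint sat (H : cgraph) (e : nat -> gV (cgG H)) (phi : formula) : bool :=
  match phi with
  | FEq x y => e x == e y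
  | FEdge x y => gE (e x) (e y)
  | FCol c x => @cgcol H (e x) c
  | FNot p => ~~ sat e p
  | FAnd p q => sat e p && sat e q
  | FEx x p => [exists v, sat (fun i => if i == x then v else e i) p]
  end.

(* psi(x,y): x is variable 0, y is variable 1 (every other variable is read as y) *)
Definition sat2 (H : cgraph) (psi : formula) (u v : gV (cgG H)) : bool :=
  sat (fun i => if i == 0 then u else v) psi.
(* delta(x): every variable is read as x *)
Definition sat1 (H : cgraph) (delta : formula) (v : gV (cgG H)) : bool :=
  sat (fun _ => v) delta.
Arguments sat2 H psi u v : clear implicits.
Arguments sat1 H delta v : clear implicits.

Record interp := Interp {
  ipsi : formula;
  idelta : formula;
  ipsi_sym : forall (H : cgraph) (u v : gV (cgG H)), sat2 H ipsi u v = sat2 H ipsi v u;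
  ipsi_irr : forall (H : cgraph) (u : gV (cgG H)), ~~ sat2 H ipsi u u }.

Definition interpret (I : interp) (H : cgraph) : graph :=
  @Graph {v : gV (cgG H) | sat1 H (idelta I) v}
    (fun u v => sat2 H (ipsi I) (val u) (val v))
    (fun u v => @ipsi_sym I H (val u) (val v))
    (fun u => negbTE (@ipsi_irr I H (val u))).

Fixpoint within (G : graph) (r : nat) (u v : gV G) : bool :=
  match r with
  | 0 => u == v
  | r'.+1 => within r' u v || [exists w, within r' u w && gE w v]
  end.

Definition ball (G : graph) (r : nat) (v : gV G) : {set gV G} :=
  [set w | within r v w].

Definition nbhd (G : graph) (v : gV G) : {set gV G} := [set w | gE v w].
Definition deg (G : graph) (v : gV G) : nat := #|nbhd v|.

Definition has_range (I : interp) (b : nat) : Prop :=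
  forall (H : cgraph) (u v : gV (cgG H)),
    ~~ within b u v -> ~~ sat2 H (ipsi I) u v.

Definition bounded_range (I : interp) : Prop := exists b, has_range I b.

Definition loc_almost_bdd_deg (D : cgraph -> Prop) : Prop :=
  exists f d : nat -> nat, forall (r : nat) (H : cgraph), D H ->
    forall v : gV (cgG H),
      #|[set w in ball r v | d r < deg w]| <= f r.

Definition induced (G : graph) (A : {set gV G}) : graph :=
  @Graph {x : gV G | x \in A}
    (fun x y => gE (val x) (val y))
    (fun x y => gE_sym (val x) (val y))
    (fun x => gE_irr (val x)).

Definition near_twins (G : graph) (k : nat) (u v : gV G) : bool :=
  #|(nbhd u :\: nbhd v) :|: (nbhd v :\: nbhd u)| <= k.

Definition near_covered (G : graph) (k m : nat) : Prop :=
  forall S : {set gV G},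
    {in S &, forall u v, u != v -> ~~ near_twins k u v} -> #|S| <= m.

Definition loc_almost_near_covered (C : graph -> Prop) : Prop :=
  exists k m : nat -> nat, forall (r : nat) (G : graph), C G ->
    forall v : gV G, near_covered (induced (ball r v)) (k r) (m r).

Definition graph_iso (G1 G2 : graph) : Prop :=
  exists f : gV G1 -> gV G2, bijective f /\ forall x y, gE x y = gE (f x) (f y).

(* Main.v *)
Require Import Defs.
From mathcomp Require Import all_boot fingroup perm zify.
Set Implicit Arguments.
Unset Strict Implicit.
Unset Printing Implicit Defensive.

(** Interpretable implies near-covered.  In a ball of the host graph, isolate the boundedly many
    vertices of large degree and record adjacency to them by colors.  Small balls of what
    remains have boundedly many isomorphism types, and Hanf's counting argument, played inside
    a single graph, shows that psi(u,w) = psi(u',w) whenever u and u' have isomorphic balls and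
    w is far from both; only boundedly many w are not far.

    Near-covered implies interpretable.  With k = k(10), choose a maximal set X of vertices of
    degree > k that are pairwise not k-near-twins, and attach every vertex of degree > k to a
    near-twin in X.  Two large clusters are almost completely or almost not joined; complement
    the dense pairs and record this by an edge between new hub vertices, one per cluster.  In
    the resulting graph large degrees are locally rare: by averaging, representatives of degree
    > 2 k(R) in an R-ball that are mutual k(R)-near-twins have half of them in a common
    neighbourhood, where at most m(10) representatives fit. *)

(** * Finite sets: a union bound and the extension of injections to permutations *)

Lemma card_bigcup_leq (I T : finType) (A : {set I}) (F : I -> {set T}) n :
  (forall i, i \in A -> #|F i| <= n) -> #|\bigcup_(i in A) F i| <= #|A| * n.
Proof.
move=> h; rewrite -sum_nat_const.
elim/big_rec2: _ => [|i m B iA IH]; first by rewrite cards0.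
by apply: leq_trans (leq_card_setU _ _) _; apply: leq_add => //; apply: h.
Qed.

(** The complements of [D] and of [f @: D] have equal size, so their enumerations are matched index
    by index. Partial isomorphisms can thus be handled as permutations, which compose and invert. *)
Lemma perm_extend (T : finType) (D : {set T}) (f : T -> T) :
  {in D &, injective f} -> exists s : {perm T}, {in D, s =1 f}.
Proof.
move=> injf.
pose D' := ~: D; pose I' := ~: (f @: D).
have sz : size (enum D') = size (enum I').
  rewrite -!cardE; have := cardsC D; have := cardsC (f @: D).
  by rewrite card_in_imset // /D' /I'; lia.
pose g x := if x \in D then f x else nth x (enum I') (index x (enum D')).
have gI x : x \notin D -> g x \in I'.
  move=> xD; rewrite /g (negbTE xD) -mem_enum mem_nth // -sz index_mem mem_enum.
  by rewrite inE.
have gD x : x \in D -> g x \in f @: D by move=> xD; rewrite /g xD imset_f.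
have injg : injective g.
  move=> x y; case: (boolP (x \in D)) => xD; case: (boolP (y \in D)) => yD e.
  - by move: e; rewrite /g xD yD => /injf; apply.
  - by have := gI _ yD; rewrite -e inE gD.
  - by have := gI _ xD; rewrite e inE gD.
  move: e; rewrite /g (negbTE xD) (negbTE yD).
  have ix : index x (enum D') < size (enum I') by rewrite -sz index_mem mem_enum inE.
  have iy : index y (enum D') < size (enum I') by rewrite -sz index_mem mem_enum inE.
  rewrite (set_nth_default x y iy) => /eqP; rewrite nth_uniq ?enum_uniq // => /eqP e.
  by rewrite -(nth_index x (s:=enum D') (x:=x)) ?mem_enum ?inE // e nth_index // mem_enum inE.
by exists (perm injg) => x xD; rewrite permE /g xD.
Qed.

(** * Distance and balls *)

Section Within.
Variable G : graph.
Implicit Types u v w : gV G.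

Lemma withinS r u v :
  within r.+1 u v = within r u v || [exists w, within r u w && gE w v].
Proof. by []. Qed.

Lemma within_refl r u : within r u u.
Proof. by elim: r => //= r ->. Qed.

Lemma within_leq m n u v : m <= n -> within m u v -> within n u v.
Proof.
move=> /subnK <-; elim: (n - m) => // k IH /IH h.
by rewrite addSn withinS h.
Qed.

Lemma within_edge r u v w : within r u v -> gE v w -> within r.+1 u w.
Proof.
by move=> h e; rewrite withinS; apply/orP; right; apply/existsP; exists v; rewrite h.
Qed.

Lemma within_trans m n u v w : within m u v -> within n v w -> within (m + n) u w.
Proof.
move=> huv; elim: n w => [w /eqP <-|n IH w]; first by rewrite addn0.
rewrite withinS addnS => /orP[/IH|/existsP[x /andP[/IH h e]]].
  by apply: within_leq.
exact: within_edge h e.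
Qed.

Lemma within1 u v : gE u v -> within 1 u v.
Proof. exact: within_edge (within_refl 0 u). Qed.

Lemma within_sym_imp r u v : within r u v -> within r v u.
Proof.
elim: r v => [v /eqP ->|r IH v]; first exact: within_refl.
rewrite withinS => /orP[/IH|/existsP[w /andP[/IH h e]]].
  exact: within_leq.
by rewrite -add1n; apply: within_trans h; apply: within1; rewrite gE_sym.
Qed.

Lemma within_sym r u v : within r u v = within r v u.
Proof. by apply/idP/idP; apply: within_sym_imp. Qed.

Lemma card_ball_leq (d m : nat) u :
  (forall x, within m u x -> deg x <= d) -> #|ball m u| <= d.+1 ^ m.
Proof.
elim: m => [_|m IH hd].
  by rewrite (_ : ball 0 u = [set u]) ?cards1 //; apply/setP=> x; rewrite !inE eq_sym.
have hm : #|ball m u| <= d.+1 ^ m.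
  by apply: IH => x hx; apply: hd; apply: within_leq hx.
have sub : ball m.+1 u \subset \bigcup_(x in ball m u) (x |: nbhd x).
  apply/subsetP=> y; rewrite inE withinS => /orP[h|/existsP[w /andP[h e]]].
    by apply/bigcupP; exists y; rewrite !inE ?eqxx.
  by apply/bigcupP; exists w; rewrite !inE ?e ?orbT.
apply: leq_trans (subset_leq_card sub) _.
apply: leq_trans (card_bigcup_leq (n := d.+1) _) _.
  move=> x; rewrite inE => hx; apply: leq_trans (leq_card_setU _ _) _.
  by rewrite cards1 add1n ltnS; apply: hd; apply: within_leq hx.
by rewrite expnSr leq_mul2r hm orbT.
Qed.

End Within.

(** * Hanf locality inside one graph *)

Section Locality.
Variables (G : graph) (K : eqType) (col : gV G -> K).
Let T := gV G.
Implicit Types (s t : {perm T}) (A B : {set T}).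

(** Only [x] is confined to the [n]-balls around [A]; [y] is arbitrary, so edges leaving these balls
    are respected as well. Pairs of vertices outside the balls are unconstrained. *)
Definition local_iso n s A : bool :=
  [forall a in A, forall x, within n a x ==>
     (col (s x) == col x) && [forall y, gE (s x) (s y) == gE x y]].

Lemma local_isoP n s A :
  reflect (forall a x, a \in A -> within n a x ->
             col (s x) = col x /\ forall y, gE (s x) (s y) = gE x y)
          (local_iso n s A).
Proof.
apply: (iffP 'forall_in_forallP) => h a.
  move=> x aA hx; have := implyP (h a aA x) hx.
  by case/andP=> /eqP -> /forallP h2; split=> // y; apply/eqP.
move=> aA x; apply/implyP=> hx; have [-> h2] := h a x aA hx.
by rewrite eqxx; apply/forallP=> y; apply/eqP.
Qed.

Lemma local_iso_sub m n s A B :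
  (forall b, b \in B -> exists2 a, a \in A & within (n - m) a b) ->
  m <= n -> local_iso n s A -> local_iso m s B.
Proof.
move=> sub lemn /local_isoP h; apply/local_isoP=> b x /sub[a aA hab] hbx.
by apply: (h a) => //; rewrite -(subnK lemn); apply: within_trans hab hbx.
Qed.

(** A path of length at most [n.+1] from [a] takes each step out of a vertex of the [n]-ball, where
    adjacency is preserved; hence the bound exceeds [n] by one. *)
Lemma local_iso_within n s A m a x :
  local_iso n s A -> a \in A -> m <= n.+1 -> within m (s a) (s x) = within m a x.
Proof.
move=> /local_isoP h aA; elim: m x => [|m IH] x lemn.
  by rewrite /= (inj_eq perm_inj).
rewrite !withinS IH; last by lia.
congr orb; apply/existsP/existsP => [[w' /andP[]]|[w /andP[hw e]]].
  rewrite -[w'](permKV s) IH; last by lia.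
  move=> hw; have [_ ->] := h a _ aA (within_leq (lemn : m <= n) hw).
  by exists ((s^-1)%g w'); rewrite hw.
exists (s w); rewrite IH ?hw; last by lia.
by have [_ ->] := h a _ aA (within_leq (lemn : m <= n) hw).
Qed.

Lemma local_iso_inv n s A : local_iso n s A -> local_iso n s^-1%g (s @: A).
Proof.
move=> h; apply/local_isoP=> _ x' /imsetP[a aA ->].
rewrite -[x'](permKV s); set x := (s^-1)%g x'.
rewrite (local_iso_within _ h aA) // => hx.
have /local_isoP/(_ a x aA hx)[c e] := h.
by rewrite permK c; split=> // y; rewrite -{2}[y](permKV s) e.
Qed.

Lemma local_iso_comp n s t A :
  local_iso n s A -> local_iso n t (s @: A) -> local_iso n (s * t)%g A.
Proof.
move=> hs ht; apply/local_isoP=> a x aA hx; rewrite !permM.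
have /local_isoP/(_ a x aA hx)[cs es] := hs.
have hx' : within n (s a) (s x) by rewrite (local_iso_within _ hs aA).
have /local_isoP/(_ _ _ (imset_f _ aA) hx')[ct et] := ht.
by rewrite ct cs; split=> // y; rewrite permM et es.
Qed.

Definition same_type n x y : bool :=
  [exists s : {perm T}, (s x == y) && local_iso n s [set x]].

Lemma same_type_refl n x : same_type n x x.
Proof.
apply/existsP; exists 1%g; rewrite perm1 eqxx /=.
by apply/local_isoP=> a y _ _; rewrite perm1; split=> // z; rewrite perm1.
Qed.

Lemma same_type_sym n x y : same_type n x y -> same_type n y x.
Proof.
case/existsP=> s /andP[/eqP <- /local_iso_inv h]; apply/existsP.
by exists s^-1%g; rewrite permK eqxx -[X in local_iso _ _ X]imset_set1.
Qed.

Lemma same_type_trans n x y z : same_type n x y -> same_type n y z -> same_type n x z.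
Proof.
case/existsP=> s /andP[/eqP <- hs] /existsP[t /andP[/eqP <- ht]].
apply/existsP; exists (s * t)%g; rewrite permM eqxx.
by apply: local_iso_comp; rewrite ?imset_set1.
Qed.

(** The distance conditions make the [n.+1]-neighbourhoods of [A] and [B] disjoint, and their images
    too, so [s] on the one and [t] on the other form an injection, which extends to a
    permutation. *)
Lemma local_iso_glue n s t A B :
  local_iso n s A -> local_iso n t B ->
  (forall a b, a \in A -> b \in B -> ~~ within (2 * n.+1) a b) ->
  (forall a b, a \in A -> b \in B -> ~~ within (2 * n.+1) (s a) (t b)) ->
  exists u : {perm T}, [/\ {in A, u =1 s}, {in B, u =1 t} & local_iso n u (A :|: B)].
Proof.
move=> hs ht dAB dst.
pose N (C : {set T}) := [set x | [exists a in C, within n.+1 a x]].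
have NP (C : {set T}) x : reflect (exists2 a, a \in C & within n.+1 a x) (x \in N C).
  by rewrite inE; apply: exists_inP.
have sub (C : {set T}) x : x \in C -> x \in N C.
  by move=> xC; apply/NP; exists x => //; apply: within_refl.
have dj x : x \in N A -> x \notin N B.
  case/NP=> a aA ha; apply/negP=> /NP[b bB hb]; move: (dAB a b aA bB).
  by rewrite mul2n -addnn (within_trans ha) // within_sym.
have dj' x y : x \in N A -> y \in N B -> s x != t y.
  case/NP=> a aA ha /NP[b bB hb]; apply/negP=> /eqP e; move: (dst a b aA bB).
  rewrite mul2n -addnn (@within_trans _ _ _ _ (s x)) //.
    by rewrite (local_iso_within _ hs aA).
  by rewrite e within_sym (local_iso_within _ ht bB).
pose f x := if x \in N A then s x else t x.
have [|u uf] := @perm_extend T (N A :|: N B) f.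
  move=> x y; rewrite !in_setU /f.
  case: (boolP (x \in N A)) => xA; case: (boolP (y \in N A)) => yA //= xB yB.
  - exact: perm_inj.
  - by move=> e; have := dj' x y xA yB; rewrite e eqxx.
  - by move=> e; have := dj' y x yA xB; rewrite e eqxx.
  - exact: perm_inj.
have uA : {in N A, u =1 s} by move=> x xA; rewrite uf ?in_setU ?xA // /f xA.
have uB : {in N B, u =1 t}.
  move=> x xB; rewrite uf ?in_setU ?xB ?orbT // /f.
  by case: ifP => // /dj; rewrite xB.
(* An edge leaving the n-ball of C ends in N C; u agrees there with the local isomorphism r. *)
have key (C : {set T}) (r : {perm T}) : local_iso n r C -> {in N C, u =1 r} -> local_iso n u C.
  move=> hr ur; apply/local_isoP=> a x aC hx.
  have xN : x \in N C by apply/NP; exists a => //; apply: within_leq hx.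
  have /local_isoP/(_ a x aC hx)[c e] := hr.
  rewrite ur //; split=> // y; case: (boolP (y \in N C)) => yN; first by rewrite ur.
  have -> : gE x y = false.
    by apply: contraNF yN => exy; apply/NP; exists a => //; apply: within_edge hx exy.
  apply: contraNF yN => exy.
  have hxy : within n.+1 (r a) (u y).
    by apply: within_edge exy; rewrite (local_iso_within _ hr aC).
  move: hxy; rewrite -[u y](permKV r) (local_iso_within _ hr aC) // => hz.
  have zN : (r^-1)%g (u y) \in N C by apply/NP; exists a.
  have := ur _ zN; rewrite permKV => /perm_inj <-.
  exact: zN.
exists u; split=> [x xA|x xB|]; first by rewrite uA ?sub.
  by rewrite uB ?sub.
have /local_isoP hA := key A s hs uA; have /local_isoP hB := key B t ht uB.
by apply/local_isoP=> a x; rewrite in_setU => /orP[/hA|/hB]; apply.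
Qed.

(* Hanf's counting step: inside the (2n+2)-neighbourhood of A, s matches the vertices with
   the n-type of c, so if c lies outside there is a vertex of that type far from s @: A. *)
Lemma local_iso_extend n s A c :
  local_iso (3 * n + 2) s A ->
  exists2 u : {perm T}, {in A, u =1 s} & local_iso n u (c |: A).
Proof.
(* [L] is the separation that gluing needs. As [3 * n + 2] equals [n + L], [s] is still a local
   isomorphism of radius [n] at every vertex within [L] of [A]. *)
move=> hs; pose L := 2 * n.+1.
have hn (B : {set T}) : (forall b, b \in B -> exists2 a, a \in A & within L a b) -> local_iso n s B.
  move=> h; apply: local_iso_sub hs; last by lia.
  by rewrite (_ : 3 * n + 2 - n = L) // /L; lia.
case: (boolP [exists a in A, within L a c]) => [/exists_inP[a aA ha]|far].
  exists s => //; apply: hn => b /setU1P[->|bA]; first by exists a.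
  by exists b => //; apply: within_refl.
have hsA : local_iso n s A by apply: hn => b bA; exists b => //; apply: within_refl.
have [d hd dfar] : exists2 d, same_type n c d & forall a, a \in A -> ~~ within L (s a) d.
  pose P := [set x | same_type n c x].
  pose PA := [set x in P | [exists a in A, within L a x]].
  suff /existsP[d /andP[hd /forall_inP]] :
      [exists d, (d \in P) && [forall a in A, ~~ within L (s a) d]].
    by move=> h; exists d => //; rewrite inE in hd.
  apply: contraT; rewrite negb_exists => /forallP h.
  have cP : c \in P :\: PA by rewrite !inE same_type_refl (negbTE far).
  suff /subset_leq_card : P \subset s @: PA.
    rewrite card_imset; last exact: perm_inj.
    have /subset_leq_card : PA \subset P by apply/subsetP=> x; rewrite !inE => /andP[].
    have := cardsID PA P; rewrite (setIidPr _); last first.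
      by apply/subsetP=> x; rewrite !inE => /andP[].
    have : 0 < #|P :\: PA| by apply/card_gt0P; exists c.
    lia.
  apply/subsetP=> y yP; apply/imsetP; exists ((s^-1)%g y); last by rewrite permKV.
  move: (h y); rewrite yP andTb negb_forall => /existsP[a]; rewrite negb_imply negbK.
  case/andP=> aA; rewrite -{1}[y](permKV s) (local_iso_within _ hs aA); last first.
    by rewrite /L; lia.
  move=> hy; apply/setIdP; split; last by apply/exists_inP; exists a.
  rewrite inE.
  apply: (@same_type_trans _ _ y); first by rewrite inE in yP.
  apply: same_type_sym; apply/existsP; exists s; rewrite permKV eqxx.
  by apply: hn => b /set1P ->; exists a.
case/existsP: hd => t /andP[/eqP td ht].
have [a b|a b|u [uA uB hu]] := @local_iso_glue n s t A [set c] hsA ht.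
- by move=> aA /set1P ->; apply: contraNN far => h; apply/exists_inP; exists a.
- by move=> aA /set1P ->; rewrite td; apply: dfar.
by exists u => //; rewrite setUC.
Qed.

End Locality.

(** * First-order formulas under local isomorphisms *)

Fixpoint qrank (phi : formula) : nat :=
  match phi with
  | FEq _ _ | FEdge _ _ | FCol _ _ => 0
  | FNot p => qrank p
  | FAnd p q => maxn (qrank p) (qrank q)
  | FEx _ p => (qrank p).+1
  end.

Fixpoint col_bound (phi : formula) : nat :=
  match phi with
  | FEq _ _ | FEdge _ _ => 0
  | FCol c _ => c.+1
  | FNot p => col_bound p
  | FAnd p q => maxn (col_bound p) (col_bound q)
  | FEx _ p => col_bound p
  end.

(** Each quantifier is answered by one use of [local_iso_extend], which lowers the radius from
    [3 * n + 2] to [n]. *)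
Fixpoint locality_radius (q : nat) : nat :=
  if q is q'.+1 then 3 * locality_radius q' + 2 else 0.

Lemma locality_radius_leq p q : p <= q -> locality_radius p <= locality_radius q.
Proof. by move=> /subnK <-; elim: (q - p) => //= k; rewrite ?addSn /=; lia. Qed.

(* [G] is a sparser graph on the vertices of [H] whose edges, together with the colors [col],
   determine the edges of [H]. *)
Lemma sat_local_iso (H : cgraph) (V := gV (cgG H)) (E : rel V) (sE : symmetric E)
    (iE : irreflexive E) (K : eqType) (col : V -> K) (N : nat) (G := Graph sE iE) :
  (forall x y x' y', col x = col x' -> col y = col y' -> E x y = E x' y' ->
     gE x y = gE x' y') ->
  (forall x x' c, c < N -> col x = col x' -> @cgcol H x c = @cgcol H x' c) ->
  forall phi (s : {perm V}) (A : {set V}) (e e' : nat -> V),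
    col_bound phi <= N ->
    @local_iso G K col (locality_radius (qrank phi)) s A ->
    (forall i, e i \in A) -> (forall i, e' i = s (e i)) ->
    @sat H e phi = @sat H e' phi.
Proof.
move=> hE hc; elim=> [x y|x y|c x|p IH|p IHp q IHq|x p IH] s A e e' /= hN hs eA ee.
- by rewrite !ee (inj_eq perm_inj).
- have /local_isoP h := hs; rewrite !ee.
  have [cx ex] := h _ _ (eA x) (@within_refl G 0 _).
  have [cy _] := h _ _ (eA y) (@within_refl G 0 _).
  by apply: hE; rewrite ?cx ?cy //; apply/esym; exact: ex.
- have /local_isoP h := hs; rewrite ee; apply: hc => //.
  by have [-> _] := h _ _ (eA x) (@within_refl G 0 _).
- by rewrite (IH s A e e').
- have sub r : r <= maxn (qrank p) (qrank q) -> @local_iso G K col (locality_radius r) s A.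
    move=> le; apply: local_iso_sub hs; last exact: locality_radius_leq.
    by move=> b bA; exists b => //; apply: within_refl.
  by rewrite (IHp s A e e') ?(IHq s A e e') //; first [lia | apply: sub; lia].
apply/existsP/existsP => -[v hv].
  have [u uA hu] := @local_iso_extend G K col _ s A v hs.
  exists (u v); rewrite -(IH u (v |: A) (fun i => if i == x then v else e i)) //.
    by move=> i; case: ifP => _; rewrite !inE ?eqxx ?eA ?orbT.
  by move=> i; case: ifP => // _; rewrite ee uA.
(* The backward move is the forward move for the inverse permutation on [s @: A]. *)
have [u uA hu] := @local_iso_extend G K col _ _ _ v (local_iso_inv hs).
exists (u v); rewrite -(IH u (v |: s @: A) (fun i => if i == x then v else e' i)) //.
  by move=> i; case: ifP => _; rewrite !inE ?eqxx // ee imset_f ?orbT.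
by move=> i; case: ifP => // _; rewrite uA ee ?permK // imset_f.
Qed.

(** * Bounded range interpretations *)

Section BallCode.
Variables (G : graph) (K : finType) (col : gV G -> K).
Implicit Types u v x y : gV G.

(** The centre comes first, so that equal codes match the centres of two balls. *)
Definition ball_seq n u := u :: rem u (enum (ball n u)).

Lemma mem_ball_seq n u x : (x \in ball_seq n u) = within n u x.
Proof.
rewrite inE mem_rem_uniq ?enum_uniq // inE mem_enum inE.
by case: eqVneq => // ->; rewrite within_refl.
Qed.

Lemma ball_seq_uniq n u : uniq (ball_seq n u).
Proof. by rewrite /= mem_rem_uniqF ?rem_uniq ?enum_uniq. Qed.

Lemma size_ball_seq n u : size (ball_seq n u) = #|ball n u|.
Proof.
have uB : u \in enum (ball n u) by rewrite mem_enum inE within_refl.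
by rewrite /= size_rem // -cardE prednK //; apply/card_gt0P; exists u; rewrite -mem_enum.
Qed.

(** The type depends only on [s] and [K], so one pigeonhole bound serves all graphs. Positions past
    the end of the list read the default [u]. *)
Definition ball_code n s u :
    'I_s.+1 * {ffun 'I_s * 'I_s -> bool} * {ffun 'I_s -> K} :=
  let l := ball_seq n u in
  (inord (size l), [ffun ij : 'I_s * 'I_s => gE (nth u l ij.1) (nth u l ij.2)],
   [ffun i : 'I_s => col (nth u l i)]).

(** Matching the two listings by index preserves colors and adjacency. The codes have radius [n.+1]
    because a local isomorphism of radius [n] also controls the edges that leave the [n]-ball. *)
Lemma ball_code_same_type n s u u' :
  #|ball n.+1 u| <= s -> #|ball n.+1 u'| <= s ->
  ball_code n.+1 s u = ball_code n.+1 s u' -> same_type col n u u'.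
Proof.
rewrite -!size_ball_seq; set l := ball_seq n.+1 u; set l' := ball_seq n.+1 u' => zl zl'.
rewrite /ball_code -/l -/l' => -[/(congr1 (@nat_of_ord _))]; rewrite !inordK ?ltnS // => sz0.
have {sz0} sz : size l = size l' by [].
move=> /ffunP eE /ffunP eC.
have lE i j : i < size l -> j < size l ->
    gE (nth u' l' i) (nth u' l' j) = gE (nth u l i) (nth u l j).
  move=> hi hj.
  by have := eE (Ordinal (leq_trans hi zl), Ordinal (leq_trans hj zl)); rewrite !ffunE.
have lC i : i < size l -> col (nth u' l' i) = col (nth u l i).
  by move=> hi; have := eC (Ordinal (leq_trans hi zl)); rewrite !ffunE.
pose f x := nth u' l' (index x l).
have il x : within n.+1 u x -> index x l < size l by rewrite index_mem mem_ball_seq.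
have [|t tf] := @perm_extend _ (ball n.+1 u) f.
  move=> x y; rewrite !inE => hx hy /eqP.
  rewrite nth_uniq ?ball_seq_uniq //; try by rewrite -sz il.
  move=> /eqP.
  by apply: (@index_inj _ u l); rewrite mem_ball_seq.
have tw x : within n.+1 u x -> t x = nth u' l' (index x l) by move=> hx; rewrite tf ?inE.
have wl x : within n.+1 u x -> nth u l (index x l) = x.
  by move=> hx; rewrite nth_index ?mem_ball_seq.
have tE x y : within n.+1 u x -> within n.+1 u y -> gE (t x) (t y) = gE x y.
  by move=> hx hy; rewrite !tw // lE ?il // !wl.
have tu : t u = u' by rewrite tw ?within_refl //= eqxx.
have td m x : m <= n.+1 -> within m u x -> within m u' (t x).
  elim: m x => [|m IH] x lm; first by move=> /eqP <-; rewrite tu within_refl.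
  rewrite withinS => /orP[/IH h|/existsP[w /andP[hw e]]].
    by apply: (@within_leq _ m) => //; apply: h; lia.
  apply: (@within_edge _ _ _ (t w)); first by apply: IH => //; lia.
  rewrite tE //; first by apply: within_leq hw; lia.
  by apply: within_leq (within_edge hw e).
apply/existsP; exists t; rewrite tu eqxx; apply/local_isoP=> a x /set1P -> hx.
have hx1 : within n.+1 u x by apply: within_leq hx.
split; first by rewrite tw // lC ?il // wl.
move=> y; case: (boolP (within n.+1 u y)) => hy; first exact: tE.
have -> : gE x y = false by apply: contraNF hy => e; apply: within_edge hx e.
apply: contraNF hy => e.
have /(within_edge (td n x (leqnSn n) hx)) : gE (t x) (t y) by [].
rewrite -mem_ball_seq -/l' => hl.
pose z := nth u l (index (t y) l').
have iz : index (t y) l' < size l by rewrite sz index_mem.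
have hz : within n.+1 u z by rewrite -mem_ball_seq mem_nth.
suff /perm_inj <- : t z = t y by [].
by rewrite tw // /z index_uniq ?ball_seq_uniq // nth_index.
Qed.

End BallCode.

Definition sparse_col (N f : nat) : finType :=
  ({ffun 'I_N -> bool} * {ffun 'I_f -> bool} * {ffun 'I_f -> bool})%type.

Definition sparse_code (N f s : nat) : finType :=
  ('I_s.+1 * {ffun 'I_s * 'I_s -> bool} * {ffun 'I_s -> sparse_col N f})%type.

(* The at most f vertices of large degree are isolated and recorded in the colors; balls in
   the remaining graph are bounded. *)
Lemma sat2_code (H : cgraph) (psi : formula) (r f d : nat) (v : gV (cgG H))
    (n := locality_radius (qrank psi)) :
  #|[set w in ball (r + 2 * n.+1) v | d < deg w]| <= f ->
  exists code : gV (cgG H) -> sparse_code (col_bound psi) f (d.+1 ^ n.+1),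
    forall u u', within r v u -> within r v u' -> code u = code u' ->
      #|[set w | sat2 H psi u w != sat2 H psi u' w]| <= 2 * d.+1 ^ (2 * n.+1).
Proof.
set S := [set w in _ | _] => hS; set V := gV (cgG H).
pose E : rel V := fun x y => [&& gE x y, x \notin S & y \notin S].
have sE : symmetric E by move=> x y; rewrite /E gE_sym [(x \notin S) && _]andbC.
have iE : irreflexive E by move=> x; rewrite /E gE_irr.
pose G := Graph sE iE.
pose pos x := index x (enum S).
have posI x y : x \in S -> pos x = pos y -> x = y.
  move=> xS e; apply: (@index_inj _ x (enum S)); rewrite ?mem_enum //.
  by rewrite -mem_enum -index_mem -/(pos y) -e index_mem mem_enum.
pose col (x : V) : sparse_col (col_bound psi) f :=
  ([ffun c : 'I_(col_bound psi) => @cgcol H x c],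
   [ffun i : 'I_f => (x \in S) && (pos x == i)],
   [ffun i : 'I_f => [exists y in S, (pos y == i) && gE x y]]).
have wG m (x y : V) : @within G m x y -> @within (cgG H) m x y.
  elim: m y => [|m IH] y //; rewrite withinS => /orP[/IH|/existsP[w /andP[/IH hw]]].
    by move=> h; apply: (@within_leq _ m).
  by case/and3P=> e _ _; apply: within_edge hw e.
have bG (u : V) m : within r v u -> m <= 2 * n.+1 -> #|@ball G m u| <= d.+1 ^ m.
  move=> hu lm; apply: card_ball_leq => x /wG hx.
  have [xS|xS] := boolP (x \in S).
    by rewrite /deg (_ : nbhd _ = set0) ?cards0 //; apply/setP=> y; rewrite !inE /= /E xS andbF.
  have hd : @deg (cgG H) x <= d.
    move: xS; rewrite !inE negb_and -leqNgt => /orP[/negP[]|//].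
    apply: within_leq (within_trans hu hx); lia.
  apply: leq_trans hd; apply: subset_leq_card; apply/subsetP=> y.
  by rewrite !inE => /and3P[].
have colE x y x' y' : col x = col x' -> col y = col y' -> E x y = E x' y' -> gE x y = gE x' y'.
  (* For [a] in [S], the index component of the color forces [a' = a], and the adjacency component
     of [b] then decides the edge. *)
  have half a b a' b' : col a = col a' -> col b = col b' -> a \in S -> gE a b = gE a' b'.
    move=> [_ /ffunP ea _] [_ _ /ffunP eb] aS.
    have pa : pos a < f by apply: leq_trans hS; rewrite cardE index_mem mem_enum.
    have := ea (Ordinal pa); rewrite !ffunE /= aS eqxx => /esym/andP[a'S /eqP pa'].
    have aa : a = a' by apply: posI.
    have adj z : [exists y in S, (pos y == pos a) && gE z y] = gE a z.
      apply/exists_inP/idP => [[y0 yS /andP[/eqP /(posI _ _ yS) -> e]]|e].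
        by rewrite gE_sym.
      by exists a; rewrite // eqxx gE_sym.
    by have := eb (Ordinal pa); rewrite !ffunE /= !adj -aa.
  have inS a a' : col a = col a' -> (a \in S) -> a' \in S.
    move=> [_ /ffunP ea _] aS.
    have pa : pos a < f by apply: leq_trans hS; rewrite cardE index_mem mem_enum.
    by have := ea (Ordinal pa); rewrite !ffunE /= aS eqxx => /esym/andP[].
  move=> ex ey; have [xS _|xS] := boolP (x \in S); first exact: half.
  have [yS _|yS] := boolP (y \in S); first by rewrite gE_sym [RHS]gE_sym; apply: half.
  have x'S : x' \notin S by apply: contraNN xS; apply: inS.
  have y'S : y' \notin S by apply: contraNN yS; apply: inS.
  by rewrite /E xS yS x'S y'S !andbT.
exists (@ball_code G _ col n.+1 _) => u u' hu hu' eu.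
have /existsP[s /andP[/eqP su hs]] : @same_type G _ col n u u'.
  by apply: ball_code_same_type eu; apply: bG; rewrite //; lia.
(* If [w] is farther than [2 * n.+1] from [u] and [u'] in [G], gluing [s] at [u] with the identity
   at [w] carries the pair [u], [w] to [u'], [w], so [psi] cannot tell them apart. *)
have sub : [set w | sat2 H psi u w != sat2 H psi u' w] \subset
    @ball G (2 * n.+1) u :|: @ball G (2 * n.+1) u'.
  apply/subsetP=> w; rewrite in_set; apply: contraR.
  rewrite in_setU negb_or !in_set => /andP[fu fu'].
  have h1 : @local_iso G _ col n 1 [set w].
    by apply/local_isoP=> a y _ _; rewrite perm1; split=> // z; rewrite perm1.
  have [a b|a b|t [ta tb ht]] := @local_iso_glue G _ col n s 1 [set u] [set w] hs h1.
  - by move=> /set1P -> /set1P ->.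
  - by move=> /set1P -> /set1P ->; rewrite su perm1.
  apply/eqP; rewrite /sat2.
  apply: (@sat_local_iso H E sE iE _ col (col_bound psi) colE _ psi t ([set u] :|: [set w])) => //.
  - by move=> x x' c hc [/ffunP /(_ (Ordinal hc))]; rewrite !ffunE.
  - by move=> i; rewrite !inE; case: ifP; rewrite eqxx ?orbT.
  by move=> i; case: ifP => _; [rewrite ta ?inE // su | rewrite tb ?inE // perm1].
apply: leq_trans (subset_leq_card sub) _; apply: leq_trans (leq_card_setU _ _) _.
apply: leq_trans (leq_add (bG u _ hu (leqnn _)) (bG u' _ hu' (leqnn _))) _.
by rewrite addnn -muln2 mulnC.
Qed.

(** Vertices of a ball are sorted by their codes in the host. Equal codes make near-twins, so the
    number of codes bounds every separated set. *)
Lemma interpretable_near_covered (C : graph -> Prop) (D : cgraph -> Prop) (I : interp) :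
  loc_almost_bdd_deg D -> bounded_range I ->
  (forall G, C G -> exists H, D H /\ graph_iso G (interpret I H)) ->
  loc_almost_near_covered C.
Proof.
move=> [f [d hD]] [b hb] hC.
pose n := locality_radius (qrank (ipsi I)).
(* An edge of [G] spans distance at most [b] in the host, so an [r]-ball lands in an [r * b]-ball;
   the remaining [2 * n.+1] is the margin in [sat2_code]. *)
pose R r := r * b + 2 * n.+1.
exists (fun r => 2 * (d (R r)).+1 ^ (2 * n.+1)).
exists (fun r => #|sparse_code (col_bound (ipsi I)) (f (R r)) ((d (R r)).+1 ^ n.+1)|).
move=> r G /hC[H [DH [g [gb gE_g]]]] v.
pose h x := val (g x).
have hE x y : gE x y = sat2 H (ipsi I) (h x) (h y) by rewrite gE_g.
have hI : injective h by move=> x y /val_inj; apply: bij_inj.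
have hw m x y : within m x y -> within (m * b) (h x) (h y).
  elim: m y => [|m IH] y; first by move=> /eqP ->; apply: within_refl.
  rewrite withinS mulSn => /orP[/IH|/existsP[w /andP[/IH hw e]]].
    by apply: within_leq; lia.
  rewrite addnC; apply: within_trans hw _; apply: contraTT e => /hb.
  by rewrite hE.
have [code hcode] := sat2_code (hD (R r) H DH (h v)).
move=> S hS; pose q (x : gV (induced (ball r v))) := code (h (val x)).
apply: (@leq_card_in _ _ q) => x y xS yS e; apply/eqP; apply: contraT => /(hS x y xS yS).
have vw (z : gV (induced (ball r v))) : within (r * b) (h v) (h (val z)).
  by apply: hw; have := valP z; rewrite inE.
case/negP; apply: leq_trans (hcode _ _ (vw x) (vw y) e).
pose j (z : gV (induced (ball r v))) := h (val z).
have jI : injective j by move=> z1 z2 /hI/val_inj.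
rewrite -(card_imset _ jI); apply: subset_leq_card; apply/subsetP=> _ /imsetP[z hz ->].
by move: hz; rewrite !inE /= /j -!hE; do 2 case: (gE _ _).
Qed.

(** * Near-twins *)

Lemma double_count (T U : finType) (A : {set T}) (B : {set U}) (R : T -> U -> bool) :
  \sum_(a in A) #|[set b in B | R a b]| = \sum_(b in B) #|[set a in A | R a b]|.
Proof.
have e (V W : finType) (x : V) (Q : V -> W -> bool) (C : {set W}) :
    #|[set y in C | Q x y]| = \sum_(y in C) Q x y.
  by rewrite -sum1dep_card big_mkcondr; apply: eq_bigr => y _; case: (Q x y).
transitivity (\sum_(a in A) \sum_(b in B) R a b); first by apply: eq_bigr => a _; apply: e.
rewrite exchange_big; apply: eq_bigr => b _; apply/esym.
exact: (e U T b (fun b a => R a b) A).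
Qed.

(** The minimizing [b] is at most the average, which is bounded by counting the related pairs from
    the side of [A]. *)
Lemma ex_below_average (T U : finType) (A : {set T}) (B : {set U}) (R : T -> U -> bool) s :
  0 < #|B| -> (forall a, a \in A -> #|[set b in B | R a b]| <= s) ->
  exists2 b, b \in B & #|B| * #|[set a in A | R a b]| <= #|A| * s.
Proof.
move=> /card_gt0P[b0 b0B] h.
case: (arg_minnP (fun b => #|[set a in A | R a b]|) b0B) => b bB bmin.
exists b => //; rewrite -!sum_nat_const; apply: (@leq_trans (\sum_(b in B) #|[set a in A | R a b]|)).
  exact: leq_sum.
by rewrite -double_count; apply: leq_sum.
Qed.

Lemma card_split (T : finType) (A : {set T}) (P : pred T) :
  #|A| = #|[set x in A | P x]| + #|[set x in A | ~~ P x]|.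
Proof.
rewrite -(cardsID [set x | P x] A); congr (_ + _); apply: eq_card => x; rewrite !inE //.
exact: andbC.
Qed.

Lemma ex_maximal_separated (T : finType) (P : {set T}) (R : rel T) :
  symmetric R -> reflexive R ->
  exists X : {set T}, [/\ X \subset P, {in X &, forall x y, x != y -> ~~ R x y} &
    forall u, u \in P -> exists2 x, x \in X & R u x].
Proof.
move=> sR rR.
pose ok (X : {set T}) :=
  (X \subset P) && [forall x in X, forall y in X, (x != y) ==> ~~ R x y].
have ok0 : ok set0 by rewrite /ok sub0set; apply/forall_inP=> x; rewrite inE.
case: (arg_maxnP (fun X : {set T} => #|X|) ok0) => X /andP[XP /forall_inP sep] Xmax.
have sepX : {in X &, forall x y, x != y -> ~~ R x y}.
  by move=> x y xX yX; have /forall_inP/(_ y yX)/implyP := sep x xX.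
exists X; split=> // u uP; apply/exists_inP; apply: contraT.
rewrite negb_exists => /forallP h.
have hu x : x \in X -> ~~ R u x by move=> xX; have := h x; rewrite xX.
have uX : u \notin X by apply/negP=> /hu; rewrite rR.
have : ok (u |: X).
  rewrite /ok subUset sub1set uP XP; apply/forall_inP=> x /setU1P hx.
  apply/forall_inP=> y /setU1P hy; apply/implyP.
  case: hx => [->|xX]; case: hy => [->|yX]; rewrite ?eqxx // => nxy.
  - exact: hu.
  - by rewrite sR hu.
  - exact: sepX.
by move=> /Xmax; rewrite /= cardsU1 uX; lia.
Qed.

Section NearTwins.
Variable G : graph.
Implicit Types (u v w x y : gV G) (A B X : {set gV G}).

Lemma near_twins_sym k : symmetric (@near_twins G k).
Proof. by move=> u v; rewrite /near_twins setUC. Qed.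

Lemma near_twins_refl k : reflexive (@near_twins G k).
Proof. by move=> u; rewrite /near_twins setDv setU0 cards0. Qed.

Lemma near_twins_trans i j u v w :
  near_twins i u v -> near_twins j v w -> near_twins (i + j) u w.
Proof.
rewrite /near_twins => h1 h2; apply: leq_trans (leq_add h1 h2).
apply: leq_trans (leq_card_setU _ _); apply: subset_leq_card; apply/subsetP=> x.
by rewrite !inE; do 3 case: (gE _ x).
Qed.

Lemma near_twins_diff k u v B :
  near_twins k u v -> #|[set x in B | gE u x && ~~ gE v x]| <= k.
Proof.
apply: leq_trans; apply: subset_leq_card; apply/subsetP=> x; rewrite !inE.
by case/and3P=> _ -> ->.
Qed.

Lemma near_twins_hits k u v B : near_twins k u v ->
  #|[set x in B | gE u x]| <= #|[set x in B | gE v x]| + k.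
Proof.
move=> /(near_twins_diff B); rewrite (card_split [set x in B | gE u x] (gE v)).
move=> h; apply: leq_add; last first.
  by apply: leq_trans h; apply: subset_leq_card; apply/subsetP=> x; rewrite !inE andbA.
by apply: subset_leq_card; apply/subsetP=> x; rewrite !inE => /andP[/andP[-> _] ->].
Qed.

Lemma near_twins_misses k u v B : near_twins k u v ->
  #|[set x in B | ~~ gE u x]| <= #|[set x in B | ~~ gE v x]| + k.
Proof.
rewrite near_twins_sym => /(near_twins_hits B).
by have := card_split B (gE u); have := card_split B (gE v); lia.
Qed.

Lemma near_twins_deg k u v : near_twins k u v -> deg u <= deg v + k.
Proof.
have e w : deg w = #|[set x in [set: gV G] | gE w x]|.
  by apply: eq_card => x; rewrite !inE.
by rewrite !e; apply: near_twins_hits.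
Qed.

Lemma near_twins_common k u v B : near_twins k u v -> k < #|[set x in B | gE u x]| ->
  exists x, [/\ x \in B, gE u x & gE v x].
Proof.
move=> /(near_twins_diff B) h1 h2.
case: (set_0Vmem [set x in B | gE u x && gE v x]) => [e|[x]]; last first.
  by rewrite !inE => /and3P[? ? ?]; exists x.
move: h2; rewrite (card_split _ (gE v)).
have -> : [set x in [set x in B | gE u x] | gE v x] = set0.
  by rewrite -e; apply/setP=> x; rewrite !inE andbA.
have -> : [set x in [set x in B | gE u x] | ~~ gE v x] = [set x in B | gE u x && ~~ gE v x].
  by apply/setP=> x; rewrite !inE andbA.
by rewrite cards0; lia.
Qed.

Lemma near_twins_within k u v : near_twins k u v -> k < deg u -> within 2 u v.
Proof.
move=> /(near_twins_common (B := setT)) h hu; have [|x [_ ux vx]] := h.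
  by apply: leq_trans hu _; apply: subset_leq_card; apply/subsetP=> x; rewrite !inE.
by apply: within_edge (within1 ux) _; rewrite gE_sym.
Qed.

(** The extra unit of radius keeps every neighbour of a vertex of [S] inside the induced subgraph,
    so no symmetric difference is truncated. *)
Lemma near_covered_ball r k m v : near_covered (induced (ball r.+1 v)) k m ->
  forall S : {set gV G}, {in S, forall x, within r v x} ->
    {in S &, forall x y, x != y -> ~~ near_twins k x y} -> #|S| <= m.
Proof.
move=> cov S Sv sep; pose S' := [set x : gV (induced (ball r.+1 v)) | val x \in S].
have -> : #|S| = #|S'|.
  rewrite -(card_imset _ (@val_inj _ _ (gV (induced (ball r.+1 v))))); apply: eq_card => x.
  apply/idP/imsetP => [xS|[x' + ->]]; last by rewrite inE.
  have hx : x \in ball r.+1 v by rewrite inE (within_leq _ (Sv _ xS)).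
  by exists (Sub x hx); rewrite ?inE SubK.
apply: cov => x y; rewrite !inE => xS yS nxy; apply: contraNN (sep _ _ xS yS nxy).
rewrite /near_twins; apply: leq_trans.
rewrite -(card_imset _ (@val_inj _ _ (gV (induced (ball r.+1 v))))).
apply: subset_leq_card; apply/subsetP=> z hz; apply/imsetP.
have zB : z \in ball r.+1 v.
  rewrite inE; move: hz; rewrite !inE => /orP[] /andP[_ e].
    exact: within_edge (Sv _ xS) e.
  exact: within_edge (Sv _ yS) e.
exists (Sub z zB); last by rewrite SubK.
by move: hz; rewrite !inE.
Qed.

Definition edges A B := \sum_(a in A) #|[set b in B | gE a b]|.

Lemma edgesC A B : edges A B = edges B A.
Proof.
rewrite /edges double_count; apply: eq_bigr => b _; apply: eq_card => a.
by rewrite !inE gE_sym.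
Qed.

(* Otherwise averaging gives two vertices of B, one adjacent to most of A and one to few. *)
Lemma near_twins_dichotomy j A B a :
  {in A &, forall x y, near_twins j x y} -> {in B &, forall x y, near_twins j x y} ->
  10 * j < #|A| -> a \in A ->
  #|[set b in B | gE a b]| <= 4 * j \/ #|[set b in B | ~~ gE a b]| <= 4 * j.
Proof.
move=> twA twB cA aA.
case: (leqP #|[set b in B | gE a b]| (4 * j)) => [|h1]; first by left.
case: (leqP #|[set b in B | ~~ gE a b]| (4 * j)) => [|h2]; first by right.
exfalso; set B1 := [set b in B | gE a b] in h1; set B2 := [set b in B | ~~ gE a b] in h2.
(* Since [a] sees all of [B1], every vertex of [A] misses at most [j] of it, so some [b1] is missed
   by less than a quarter of [A]. Likewise some [b2] in [B2] is seen by less than a quarter. *)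
have [||b1 b1B m1] := @ex_below_average _ _ A B1 (fun x y => ~~ gE x y) j; first by lia.
  move=> x xA; apply: leq_trans (near_twins_diff B (twA a x aA xA)).
  by apply: subset_leq_card; apply/subsetP=> y; rewrite !inE andbA.
have [||b2 b2B m2] := @ex_below_average _ _ A B2 (@gE G) j; first by lia.
  move=> x xA; apply: leq_trans (near_twins_diff B (twA x a xA aA)).
  apply: subset_leq_card; apply/subsetP=> y; rewrite !inE => /andP[/andP[-> ->] ->] //.
have e1 : #|[set x in A | ~~ gE x b1]| = #|[set x in A | ~~ gE b1 x]|.
  by apply: eq_card => x; rewrite !inE gE_sym.
have e2 : #|[set x in A | gE x b2]| = #|[set x in A | gE b2 x]|.
  by apply: eq_card => x; rewrite !inE gE_sym.
have tw : near_twins j b1 b2 by apply: twB; [move: b1B | move: b2B]; rewrite inE => /andP[].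
(* So [b1] and [b2] differ on more than half of [A], although they are near-twins. *)
have := near_twins_hits A tw; have := card_split A (gE b1).
rewrite e1 in m1; rewrite e2 in m2; nia.
Qed.

(** If [a] saw few vertices of [B], every vertex of [A] would see at most [5 * j] of them, less than
    half of [B], and the pair would not be dense. *)
Lemma dense_misses j A B a :
  {in A &, forall x y, near_twins j x y} -> {in B &, forall x y, near_twins j x y} ->
  10 * j < #|A| -> 10 * j < #|B| -> a \in A -> #|A| * #|B| < 2 * edges A B ->
  #|[set b in B | ~~ gE a b]| <= 4 * j.
Proof.
move=> twA twB cA cB aA d; have [h|//] := near_twins_dichotomy twA twB cA aA.
have : edges A B <= #|A| * (5 * j).
  rewrite -sum_nat_const; apply: leq_sum => x xA.
  by have := near_twins_hits B (twA x a xA aA); lia.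
nia.
Qed.

Lemma sparse_hits j A B a :
  {in A &, forall x y, near_twins j x y} -> {in B &, forall x y, near_twins j x y} ->
  10 * j < #|A| -> 10 * j < #|B| -> a \in A -> 2 * edges A B <= #|A| * #|B| ->
  #|[set b in B | gE a b]| <= 4 * j.
Proof.
move=> twA twB cA cB aA d; have [//|h] := near_twins_dichotomy twA twB cA aA.
have : #|A| * (#|B| - 5 * j) <= edges A B.
  rewrite -sum_nat_const; apply: leq_sum => x xA.
  have := near_twins_misses B (twA x a xA aA); have := card_split B (gE x); lia.
have : #|A| > 0 by lia.
nia.
Qed.

End NearTwins.

(** * Encoding by clusters and flips *)

Arguments within : simpl never.

Definition FOr p q := FNot (FAnd (FNot p) (FNot q)).
Definition FXor p q := FAnd (FNot (FAnd p q)) (FOr p q).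

(** Variables 2 and 3 range over hubs adjacent to variables 0 and 1. Color 0 marks hubs; color 1
    marks a hub whose cluster is complemented within itself, in place of a loop, which a simple
    graph cannot have. *)
Definition link_formula :=
  FEx 2 (FEx 3 (FAnd (FAnd (FCol 0 2) (FCol 0 3)) (FAnd (FAnd (FEdge 0 2) (FEdge 1 3))
    (FOr (FEdge 2 3) (FAnd (FEq 2 3) (FCol 1 2)))))).

Definition decode_psi := FAnd (FNot (FEq 0 1)) (FXor (FEdge 0 1) link_formula).

Definition linked (H : cgraph) (u v : gV (cgG H)) :=
  [exists c, exists c', [&& @cgcol H c 0, @cgcol H c' 0, gE u c, gE v c' &
     gE c c' || (c == c') && @cgcol H c 1]].

Lemma linkedC (H : cgraph) (u v : gV (cgG H)) : linked u v = linked v u.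
Proof.
have imp x y : @linked H x y -> linked y x.
  case/existsP=> c /existsP[c' /and5P[hc hc' e e' h]].
  apply/existsP; exists c'; apply/existsP; exists c; rewrite hc hc' e e' gE_sym.
  by case/orP: h => [->//|/andP[/eqP -> ->]]; rewrite eqxx orbT.
by apply/idP/idP; apply: imp.
Qed.

Lemma sat2_decode (H : cgraph) (u v : gV (cgG H)) :
  sat2 H decode_psi u v = (u != v) && (gE u v (+) linked u v).
Proof.
rewrite /sat2 /=; congr (_ && _).
set L := [exists x, _]; have -> : L = linked u v.
  apply: eq_existsb => c; apply: eq_existsb => c' /=.
  by rewrite negb_and !negbK !andbA.
by case: (gE u v); case: (linked u v).
Qed.

Lemma decode_psi_sym (H : cgraph) (u v : gV (cgG H)) :
  sat2 H decode_psi u v = sat2 H decode_psi v u.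
Proof. by rewrite !sat2_decode eq_sym gE_sym linkedC. Qed.

Lemma decode_psi_irr (H : cgraph) (u : gV (cgG H)) : ~~ sat2 H decode_psi u u.
Proof. by rewrite sat2_decode eqxx. Qed.

Definition decode := @Interp decode_psi (FNot (FCol 0 0)) decode_psi_sym decode_psi_irr.

Lemma decode_bounded_range : bounded_range decode.
Proof.
exists 3 => H u v; apply: contraNN; rewrite sat2_decode => /andP[_].
case: (boolP (gE u v)) => [/within1 h _|_]; first exact: within_leq h.
rewrite addFb => /existsP[c /existsP[c' /and5P]]; case=> _ _ uc vc' h; apply: (@within_edge _ _ _ c'); last by rewrite gE_sym.
case/orP: h => [e|/andP[/eqP <- _]]; first exact: within_edge (within1 uc) e.
exact: within_leq (within1 uc).
Qed.

Section Encode.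
Variables (G : graph) (k : nat) (X : {set gV G}).
Implicit Types (u v w x y a b c : gV G).

Definition rep u := odflt u [pick x in X | near_twins k u x].
Definition cluster c := [set u | (k < deg u) && (rep u == c)].

(** The threshold [20 * k] is [10 * j] for [j = 2 * k], as members of one cluster are mutual
    [2 * k]-near-twins. The last condition is density above one half. The case [c = c'] is
    allowed. *)
Definition flip c c' :=
  [&& 20 * k < #|cluster c|, 20 * k < #|cluster c'| &
      #|cluster c| * #|cluster c'| < 2 * edges (cluster c) (cluster c')].

Definition flipped u v := [&& k < deg u, k < deg v & flip (rep u) (rep v)].

(* [inl] keeps the vertices of [G], [inr c] is the hub of the cluster with representative [c]
   (isolated if there is none). *)
Definition encode_edge (p q : gV G + gV G) : bool :=
  match p, q with
  | inl u, inl v => (u != v) && (gE u v (+) flipped u v)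
  | inl u, inr c | inr c, inl u => u \in cluster c
  | inr c, inr c' => (c != c') && flip c c'
  end.

Lemma flipC c c' : flip c c' = flip c' c.
Proof. by rewrite /flip edgesC [#|cluster c| * _]mulnC andbCA. Qed.

Lemma flippedC u v : flipped u v = flipped v u.
Proof. by rewrite /flipped flipC andbCA. Qed.

Lemma encode_edge_sym : symmetric encode_edge.
Proof. by move=> [u|c] [v|c'] //=; rewrite eq_sym ?[gE u v]gE_sym 1?flippedC 1?flipC. Qed.

Lemma encode_edge_irr : irreflexive encode_edge.
Proof. by move=> [u|c] /=; rewrite eqxx. Qed.

Definition encode : cgraph :=
  @CGraph (Graph encode_edge_sym encode_edge_irr)
    (fun p i => if p is inr c then (i == 0) || (i == 1) && flip c c else false).

Lemma linked_encode u v : @linked encode (inl u) (inl v) = flipped u v.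
Proof.
apply/existsP/idP => [[p /existsP[q /and5P[]]]|].
  case: p q => [//|c] [//|c'] _ _; rewrite /= !inE => /andP[hu /eqP ru] /andP[hv /eqP rv] h.
  rewrite /flipped hu hv ru rv /=; case/orP: h => [/andP[]//|/andP[/eqP[->]]] //.
case/and3P=> hu hv f; exists (inr (rep u)); apply/existsP; exists (inr (rep v)).
rewrite /= !inE hu hv !eqxx /=.
by case: (eqVneq (rep u) (rep v)) f => [-> ->|_ ->] //; rewrite eqxx orbT.
Qed.

(** Links between hubs recover exactly the flipped pairs, and a second exclusive or with [flipped]
    restores the edges of [G]. *)
Lemma encode_iso : graph_iso G (interpret decode encode).
Proof.
have d x : sat1 encode (idelta decode) (inl x) by [].
exists (fun x => exist _ (inl x : gV (cgG encode)) (d x)); split.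
  exists (fun p : gV (interpret decode encode) => match val p with inl x => x | inr x => x end).
    by [].
  by case=> [[x|c] h] //; apply: val_inj.
move=> x y; rewrite /= sat2_decode linked_encode.
change (gE x y = (x != y) && ((x != y) && (gE x y (+) flipped x y) (+) flipped x y)).
by case: (eqVneq x y) => [->|_] /=; rewrite ?gE_irr ?addbK.
Qed.

(** * Distances and degrees in the encoding *)

Hypothesis X_cover : forall u, k < deg u -> exists2 x, x \in X & near_twins k u x.
Variable m : nat.
Hypothesis X_local : forall v, #|[set x in X | within 9 v x]| <= m.

Lemma repP u : k < deg u -> rep u \in X /\ near_twins k u (rep u).
Proof.
move=> /X_cover[x xX hx]; rewrite /rep; case: pickP => [y /andP[]//|/(_ x)].
by rewrite /= xX hx.
Qed.

Lemma mem_cluster_rep u : k < deg u -> u \in cluster (rep u).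
Proof. by move=> hu; rewrite inE hu eqxx. Qed.

Lemma clusterP c u :
  u \in cluster c -> [/\ k < deg u, c \in X, near_twins k u c & within 2 u c].
Proof.
rewrite inE => /andP[hu /eqP <-]; have [h1 h2] := repP hu.
by split=> //; apply: near_twins_within h2 hu.
Qed.

Lemma cluster_near_twins c : {in cluster c &, forall x y, near_twins (2 * k) x y}.
Proof.
move=> x y /clusterP[_ _ hx _] /clusterP[_ _ hy _]; rewrite mul2n -addnn.
by apply: near_twins_trans hx _; rewrite near_twins_sym.
Qed.

(** A dense pair has an edge [a b], and the route through [a] and [b] has length at most 2 + 1 +
    2. *)
Lemma flip_within c c' : flip c c' -> within 5 c c'.
Proof.
case/and3P=> _ _ h.
have [a /andP[ac /card_gt0P[b]]] :
    exists a, (a \in cluster c) && (0 < #|[set b in cluster c' | gE a b]|).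
  apply/existsP; apply: contraTT h; rewrite negb_exists => /forallP h.
  rewrite /edges big1 ?muln0 // => a ac; apply/eqP.
  by have := h a; rewrite ac /= -eqn0Ngt.
rewrite inE => /andP[bc e]; have [_ _ _ wa] := clusterP ac; have [_ _ _ wb] := clusterP bc.
apply: (@within_trans _ 3 2) wb; apply: within_edge e; by rewrite within_sym.
Qed.

(** The worst case is a flipped pair: 2 from [u] to its representative, 5 between representatives, 2
    to [v]. *)
Lemma encode_edge_within (p q : gV G + gV G) :
  encode_edge p q ->
  within 9 (match p with inl x | inr x => x end) (match q with inl x | inr x => x end).
Proof.
case: p q => [u|c] [v|c'] /=.
- case/andP=> _; case: (boolP (gE u v)) => [/within1 h _|_]; first exact: within_leq h.
  rewrite addFb => /and3P[hu hv f].
  have [_ _ _ wu] := clusterP (mem_cluster_rep hu).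
  have [_ _ _ wv] := clusterP (mem_cluster_rep hv).
  apply: (@within_trans _ 7 2 _ (rep v)); last by rewrite within_sym.
  exact: (@within_trans _ 2 5 _ (rep u)) (flip_within f).
- by case/clusterP=> _ _ _; apply: within_leq.
- by case/clusterP=> _ _ _; rewrite within_sym; apply: within_leq.
by case/andP=> _ /flip_within; apply: within_leq.
Qed.

Lemma encode_within r (p q : gV (cgG encode)) :
  within r p q ->
  within (9 * r) (match p with inl x | inr x => x end) (match q with inl x | inr x => x end).
Proof.
elim: r q => [|r IH] q; first by move=> /eqP ->; apply: within_refl.
rewrite withinS => /orP[/IH|/existsP[w /andP[/IH h /encode_edge_within e]]].
  by apply: within_leq; lia.
by rewrite mulnS addnC; apply: within_trans h e.
Qed.

Lemma encoded_deg a :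
  @deg (cgG encode) (inl a) <= #|[set b | gE a b (+) flipped a b]| + 1.
Proof.
have sub : @nbhd (cgG encode) (inl a) \subset
    inl @: [set b | gE a b (+) flipped a b] :|: [set inr (rep a)].
  apply/subsetP=> -[b|c]; rewrite !inE /=.
    by case/andP=> _ h; apply/orP; left; apply/imsetP; exists b; rewrite ?inE.
  by rewrite inE => /andP[_ /eqP ->]; rewrite eqxx orbT.
apply: leq_trans (subset_leq_card sub) _; apply: leq_trans (leq_card_setU _ _) _.
by rewrite cards1 leq_add2r leq_imset_card.
Qed.

Lemma hub_deg c : @deg (cgG encode) (inr c) <= #|cluster c| + m.
Proof.
have sub : @nbhd (cgG encode) (inr c) \subset
    inl @: cluster c :|: inr @: [set x in X | within 9 c x].
  apply/subsetP=> -[b|c']; rewrite in_set /= in_setU => h; apply/orP; [left|right].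
    by rewrite imset_f.
  case/andP: h => _ f; rewrite imset_f // inE; apply/andP; split.
    case/and3P: f => _ h _.
    have /card_gt0P[b] : 0 < #|cluster c'| by apply: leq_trans h; lia.
    by case/clusterP.
  exact: within_leq (flip_within f).
apply: leq_trans (subset_leq_card sub) _; apply: leq_trans (leq_card_setU _ _) _.
apply: leq_add; first exact: leq_imset_card.
exact: leq_trans (leq_imset_card _ _) (X_local c).
Qed.

Lemma flip_misses a c : flip (rep a) c -> k < deg a ->
  #|[set b in cluster c | ~~ gE a b]| <= 20 * k.
Proof.
case/and3P=> h1 h2 h3 ha.
have := @dense_misses G (2 * k) _ _ a (@cluster_near_twins (rep a)) (@cluster_near_twins c).
rewrite mem_cluster_rep // => h; apply: leq_trans (h _ _ _ _) _ => //; lia.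
Qed.

(** Flipping gives [a] new neighbours only in clusters flipped with its own; at most [m] of these
    are in reach, and [a] misses at most [20 * k] vertices of each. *)
Lemma flipped_deg_low a :
  #|[set b | gE a b (+) flipped a b]| <= deg a + m * (20 * k).
Proof.
pose F c := [set b in cluster c | [&& k < deg a, flip (rep a) c & ~~ gE a b]].
have sub : [set b | gE a b (+) flipped a b] \subset
    nbhd a :|: \bigcup_(c in [set x in X | within 9 a x]) F c.
  apply/subsetP=> b; rewrite in_setU !in_set; case: (boolP (gE a b)) => //= e.
  case/and3P=> ha hb f; apply/bigcupP; exists (rep b); last first.
    by rewrite in_set mem_cluster_rep // ha f e.
  rewrite inE (repP hb).1; have [_ _ _ w] := clusterP (mem_cluster_rep ha).
  by apply: within_leq (within_trans w (flip_within f)).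
apply: leq_trans (subset_leq_card sub) _; apply: leq_trans (leq_card_setU _ _) _.
rewrite leq_add2l; apply: leq_trans (card_bigcup_leq (n := 20 * k) _) _; last first.
  by rewrite leq_mul2r X_local orbT.
move=> c _; rewrite /F; case: (boolP (k < deg a)) => ha; last first.
  by rewrite (_ : [set b in _ | _] = set0) ?cards0 //; apply/setP=> b; rewrite !inE andbF.
case: (boolP (flip (rep a) c)) => f; first exact: flip_misses.
by rewrite (_ : [set b in _ | _] = set0) ?cards0 //; apply/setP=> b; rewrite !inE andbF.
Qed.

(* Each vertex of the cluster sees almost all of L, so some vertex of L sees half the cluster. *)
Lemma low_neighbours a : k < deg a -> 20 * k < #|cluster (rep a)| ->
  #|[set b | gE a b && (deg b <= k)]| <= 4 * k.
Proof.
move=> ha big; set L := [set b | _]; rewrite leqNgt; apply/negP=> hL.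
have aA := mem_cluster_rep ha.
have [||l lL hl] := @ex_below_average _ _ (cluster (rep a)) L (fun x y => ~~ gE x y) (2 * k).
- by lia.
- move=> x xA; apply: leq_trans (near_twins_diff setT (cluster_near_twins aA xA)).
  by apply: subset_leq_card; apply/subsetP=> y; rewrite !inE => /andP[/andP[-> _] ->].
have hits : #|[set x in cluster (rep a) | gE x l]| <= k.
  move: lL; rewrite inE => /andP[_ dl]; apply: leq_trans dl; apply: subset_leq_card.
  by apply/subsetP=> x; rewrite !inE gE_sym => /andP[_ ->].
have := card_split (cluster (rep a)) (fun x => gE x l); nia.
Qed.

(** The bound is free of [deg a]. Each nearby cluster contributes at most [20 * k]: a small one has
    no more vertices, a dense pair leaves the few non-neighbours, a sparse pair the few neighbours.
    Neighbours of degree at most [k] are counted by [low_neighbours]. *)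
Lemma flipped_deg_big a : k < deg a -> 20 * k < #|cluster (rep a)| ->
  #|[set b | gE a b (+) flipped a b]| <= 4 * k + m * (20 * k).
Proof.
move=> ha big; pose F c := [set b in cluster c | gE a b (+) flip (rep a) c].
have sub : [set b | gE a b (+) flipped a b] \subset
    [set b | gE a b && (deg b <= k)] :|: \bigcup_(c in [set x in X | within 9 a x]) F c.
  apply/subsetP=> b; rewrite in_setU !in_set; case: (leqP (deg b) k) => hb.
    by rewrite /flipped [k < deg b]ltnNge hb andbF addbF => ->.
  rewrite andbF /= => h; apply/bigcupP; exists (rep b); last first.
    by move: h; rewrite in_set mem_cluster_rep // /flipped ha hb.
  have [_ rX _ wb] := clusterP (mem_cluster_rep hb).
  rewrite inE rX; case: (boolP (gE a b)) h => [/within1 e _|_]; first exact: within_leq (within_trans e wb).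
  rewrite addFb => /and3P[_ _ f].
  have [_ _ _ w] := clusterP (mem_cluster_rep ha).
  by apply: within_leq (within_trans w (flip_within f)).
apply: leq_trans (subset_leq_card sub) _; apply: leq_trans (leq_card_setU _ _) _.
apply: leq_add; first exact: low_neighbours.
apply: leq_trans (card_bigcup_leq (n := 20 * k) _) _; last first.
  by rewrite leq_mul2r X_local orbT.
move=> c _; rewrite /F; case: (leqP #|cluster c| (20 * k)) => small.
  by apply: leq_trans small; apply: subset_leq_card; apply/subsetP=> b; rewrite !inE => /andP[].
case: (boolP (flip (rep a) c)) => f.
  rewrite (_ : [set b in _ | _] = [set b in cluster c | ~~ gE a b]); first exact: flip_misses.
  by apply/setP=> b; rewrite !inE addbT.
rewrite (_ : [set b in _ | _] = [set b in cluster c | gE a b]); last first.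
  by apply/setP=> b; rewrite !inE addbF.
move: f; rewrite /flip big small /= -leqNgt => f.
have := @sparse_hits G (2 * k) _ _ a (@cluster_near_twins (rep a)) (@cluster_near_twins c).
rewrite mem_cluster_rep // => h; apply: leq_trans (h _ _ _ _) _ => //; lia.
Qed.

(** * Large degrees are locally rare in the encoding *)

Section Ball.
Variables (v : gV G) (R j mR : nat).
Hypothesis cov : forall S : {set gV G}, {in S, forall x, within R v x} ->
  {in S &, forall x y, x != y -> ~~ near_twins j x y} -> #|S| <= mR.

Definition high_reps := [set x in X | within R v x && (2 * j < deg x)].

(* Representatives that are j-near-twins of z have half of them in one neighbourhood,
   which holds at most m of them. *)
Lemma card_high_reps : #|high_reps| <= mR * (2 * m).
Proof.
have [Z [ZY Zsep Zcov]] :=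
  @ex_maximal_separated _ high_reps _ (@near_twins_sym G j) (@near_twins_refl G j).
have YP y : y \in high_reps -> [/\ y \in X, within R v y & 2 * j < deg y].
  by rewrite inE => /and3P.
have cZ : #|Z| <= mR by apply: cov Zsep => z /(subsetP ZY)/YP[].
have sub : high_reps \subset \bigcup_(z in Z) [set y in high_reps | near_twins j y z].
  by apply/subsetP=> y yY; have [z zZ h] := Zcov y yY; apply/bigcupP; exists z; rewrite // inE yY.
apply: leq_trans (subset_leq_card sub) _.
apply: leq_trans (card_bigcup_leq (n := 2 * m) _) _; last by rewrite leq_mul2r cZ orbT.
move=> z /(subsetP ZY)/YP[_ _ dz]; set Yz := [set y in _ | _].
have [||b bz hb] := @ex_below_average _ _ Yz (nbhd z) (fun x y => ~~ gE x y) j.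
- by rewrite -/(deg z); lia.
- move=> y; rewrite inE near_twins_sym => /andP[_ tw].
  apply: leq_trans (near_twins_diff setT tw).
  by apply: subset_leq_card; apply/subsetP=> x; rewrite !inE.
have hits : #|[set y in Yz | gE y b]| <= m.
  apply: leq_trans (X_local b); apply: subset_leq_card; apply/subsetP=> y.
  rewrite !inE => /andP[/andP[/andP[-> _] _]]; rewrite gE_sym => /within1; exact: within_leq.
have := card_split Yz (fun y => gE y b); rewrite -/(deg z) in hb; nia.
Qed.

Lemma high_rep a : within (R - 2) v a -> 2 <= R -> 2 * j + k < deg a ->
  k < deg a /\ rep a \in high_reps.
Proof.
move=> wa hR da; have ha : k < deg a by lia.
split=> //; have [_ rX tw w] := clusterP (mem_cluster_rep ha).
rewrite inE rX -{1}(subnK hR) (within_trans wa w) /=.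
by have := near_twins_deg tw; lia.
Qed.

(* A large cluster of small-degree vertices has a common neighbour of large degree. *)
Lemma big_cluster c : within (R - 3) v c -> 3 <= R -> 2 * j * (2 * j + k) < #|cluster c| ->
  c \in high_reps :|: \bigcup_(y in high_reps) [set x in X | within 9 y x].
Proof.
move=> wc hR big; have /card_gt0P[a0 a0c] : 0 < #|cluster c| by lia.
have [_ cX _ _] := clusterP a0c.
rewrite in_setU inE cX; have -> : within R v c by apply: within_leq wc; lia.
case: (leqP (deg c) (2 * j)) => // dc; apply/bigcupP.
(* Every vertex of the cluster shares a neighbour with [c], which has at most [2 * j] neighbours, so
   one of these sees more than [2 * j + k] cluster vertices. *)
have [z /andP[cz hz]] : exists z, gE c z && (2 * j + k < #|[set a in cluster c | gE z a]|).
  apply/existsP; apply: contraTT big; rewrite negb_exists => /forallP h; rewrite -leqNgt.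
  have sub : cluster c \subset \bigcup_(z in nbhd c) [set a in cluster c | gE z a].
    apply/subsetP=> a ac; have [ha _ tw _] := clusterP ac.
    have [|z [_ az cz]] := near_twins_common (B := setT) tw.
      by apply: leq_trans ha _; apply: subset_leq_card; apply/subsetP=> x; rewrite !inE.
    by apply/bigcupP; exists z; rewrite ?inE // gE_sym az andbT; rewrite inE in ac.
  apply: leq_trans (subset_leq_card sub) _.
  apply: leq_trans (card_bigcup_leq (n := 2 * j + k) _) _; last by rewrite leq_mul2r dc orbT.
  by move=> z; rewrite inE => cz; have := h z; rewrite cz /= -leqNgt.
have dz : 2 * j + k < deg z.
  apply: leq_trans hz _; apply: subset_leq_card; apply/subsetP=> x; rewrite !inE.
  by case/andP.
have [] := @high_rep z _ _ dz; [|by lia|].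
  rewrite (_ : R - 2 = (R - 3) + 1); last by lia.
  exact: within_trans wc (within1 cz).
move=> kz rz; exists (rep z) => //; rewrite inE cX.
(* The representative of [z] misses at most [k] of the cluster vertices that [z] sees, so it is
   adjacent to some [x] in the cluster and within 1 + 2 of [c]. *)
have [_ tw] := repP kz; have [|x [xc _ rx]] := near_twins_common (B := cluster c) tw; first by lia.
have [_ _ _ wx] := clusterP xc.
exact: within_leq (within_trans (within1 rx) wx).
Qed.

End Ball.

(** An original vertex of large degree has its representative in [Y] and, by [flipped_deg_big], a
    small cluster, so it lies in [A]. A hub of large degree has a large cluster and lies in [B]. The
    radius is 9 per step of the encoding plus the 3 of [big_cluster]. *)
Lemma encode_ball r j mR (p : gV (cgG encode)) (v := match p with inl x | inr x => x end) :
  (forall S : {set gV G}, {in S, forall x, within (9 * r + 3) v x} ->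
    {in S &, forall x y, x != y -> ~~ near_twins j x y} -> #|S| <= mR) ->
  #|[set q in ball r p | 2 * j * (2 * j + k) + 2 * j + 5 * k + m * (20 * k) + m + 1 < deg q]|
    <= mR * (2 * m) * (20 * k + m + 1).
Proof.
move=> cov; set d := _ + 1; pose Y := high_reps v (9 * r + 3) j.
have cY : #|Y| <= mR * (2 * m) := card_high_reps cov.
pose A := \bigcup_(c in Y) (if #|cluster c| <= 20 * k then cluster c else set0).
pose B := Y :|: \bigcup_(y in Y) [set x in X | within 9 y x].
have cA : #|A| <= #|Y| * (20 * k).
  by apply: card_bigcup_leq => c _; case: ifP => //; rewrite cards0.
have cB : #|B| <= #|Y| + #|Y| * m.
  apply: leq_trans (leq_card_setU _ _) _; rewrite leq_add2l.
  by apply: card_bigcup_leq => y _; apply: X_local.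
have sub : [set q in ball r p | d < deg q] \subset inl @: A :|: inr @: B.
  apply/subsetP=> q; rewrite in_set in_set => /andP[/encode_within]; rewrite -/v => w dq.
  rewrite in_setU; case: q w dq => [a|c] w dq; apply/orP; [left|right]; rewrite imset_f //.
    have h1 := encoded_deg a; have h2 := flipped_deg_low a.
    have [|||ha ra] := @high_rep v (9 * r + 3) j a.
    - by rewrite /= in w; apply: within_leq w; lia.
    - by lia.
    - by rewrite /d in dq; lia.
    apply/bigcupP; exists (rep a) => //; case: leqP => big; first exact: mem_cluster_rep.
    by have := flipped_deg_big ha big; rewrite /d in dq; lia.
  apply: big_cluster; [by rewrite addnK | by lia |].
  by have := hub_deg c; rewrite /d in dq; lia.
apply: leq_trans (subset_leq_card sub) _; apply: leq_trans (leq_card_setU _ _) _.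
apply: (@leq_trans (#|A| + #|B|)); first by apply: leq_add; apply: leq_imset_card.
nia.
Qed.

End Encode.

(** * Assembly of the two directions *)

Lemma near_covered_interpretable (C : graph -> Prop) :
  loc_almost_near_covered C ->
  exists (D : cgraph -> Prop) (I : interp),
    loc_almost_bdd_deg D /\ bounded_range I /\
    (forall G, C G -> exists H, D H /\ graph_iso G (interpret I H)).
Proof.
(* Radius 10 is the 9 of [X_local] plus the unit that [near_covered_ball] spends. *)
move=> [k [m hC]]; pose k0 := k 10; pose m0 := m 10.
pose good G (X : {set gV G}) := {in X &, forall x y, x != y -> ~~ near_twins k0 x y} /\
  (forall u, k0 < deg u -> exists2 x, x \in X & near_twins k0 u x).
exists (fun H => exists G, C G /\ exists2 X : {set gV G}, good G X & H = encode k0 X).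
exists decode; split; last split; last first.
- move=> G CG.
  have [X [_ Xs Xc]] := @ex_maximal_separated _ [set u : gV G | k0 < deg u] _
    (@near_twins_sym G k0) (@near_twins_refl G k0).
  exists (encode k0 X); split; last exact: encode_iso.
  exists G; split=> //; exists X => //; split=> // u hu.
  by apply: Xc; rewrite inE.
- exact: decode_bounded_range.
pose R r := (9 * r + 3).+1.
exists (fun r => m (R r) * (2 * m0) * (20 * k0 + m0 + 1)).
exists (fun r => 2 * k (R r) * (2 * k (R r) + k0) + 2 * k (R r) + 5 * k0
                 + m0 * (20 * k0) + m0 + 1).
move=> r _ [G [CG [X [Xs Xc] ->]]] p.
apply: encode_ball => //.
  move=> v; apply: (near_covered_ball (hC 10 G CG v)).
    by move=> x; rewrite inE => /andP[].
  by move=> x y; rewrite !inE => /andP[xX _] /andP[yX _]; apply: Xs.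
exact: near_covered_ball (hC (R r) G CG _).
Qed.

Theorem theorem5p8 (C : graph -> Prop) :
  (exists (D : cgraph -> Prop) (I : interp),
      loc_almost_bdd_deg D /\ bounded_range I /\
      (forall G, C G -> exists H, D H /\ graph_iso G (interpret I H)))
  <-> loc_almost_near_covered C.
Proof.
split; last exact: near_covered_interpretable.
by move=> [D [I [hD [hI hC]]]]; apply: interpretable_near_covered hD hI hC.
Qed.
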